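(* Let $d$ be an integer with $1\le d<q$, and let $r=\sum_{a=1}^{i}\binom{m+d-a}{d-1}-t$ for some positive integer $i\le m+1$ and some nonnegative integer $t<d$. Then $$e_r(d,m)=\mathsf{p}_{m-i}+t\quad\text{and consequently}\quad d_r(\mathrm{PRM}_q(d,m))=\mathsf{p}_m-\mathsf{p}_{m-i}-t.$$
   Context: Let $q$ be a prime power, $\mathbb{F}_q$ the finite field with $q$ elements, $m$ a positive integer. For $j\in\mathbb{Z}$, $\mathsf{p}_j=q^j+\dots+q+1$ if $j\ge0$ and $\mathsf{p}_j=0$ if $j<0$ (so $\mathsf{p}_m=|\mathbb{P}^m(\mathbb{F}_q)|$). $e_r(d,m)$ is the maximum, over all families of $r$ linearly independent homogeneous polynomials of degree $d$ in $\mathbb{F}_q[x_0,\dots,x_m]$, of the number of points of $\mathbb{P}^m(\mathbb{F}_q)$ at which all of them vanish. Fix representatives $P_1,\dots,P_{\mathsf{p}_m}\in\mathbb{F}_q^{m+1}$ of the points of $\mathbb{P}^m(\mathbb{F}_q)$. The projective Reed–Muller code $\mathrm{PRM}_q(d,m)$ is the image of the space of homogeneous degree-$d$ polynomials under $F\mapsto(F(P_1),\dots,F(P_{\mathsf{p}_m}))$. For a linear code $C\subseteq\mathbb{F}_q^n$ of dimension $k$ and $1\le r\le k$, the $r$-th generalized Hamming weight is $d_r(C)=\min\{|\mathrm{Supp}(D)|: D\subseteq C \text{ a subspace}, \dim D=r\}$, where $\mathrm{Supp}(D)=\{i: c_i\neq0\text{ for some }c\in D\}$. *)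

(* Defs.v *)
From HB Require Import structures.
From mathcomp Require Import all_boot all_order all_algebra all_field.
From mathcomp Require Import mpoly.
Set Implicit Arguments. Unset Strict Implicit. Unset Printing Implicit Defensive.
Import Order.TTheory GRing.Theory.
Local Open Scope ring_scope.

Definition pj (q : nat) (j : int) : nat :=
  match j with
  | Posz n => (\sum_(k < n.+1) q ^ k)%N
  | Negz _ => 0%N
  end.

Section Proj.
Variables (F : finFieldType) (m : nat).

Definition vec := {ffun 'I_m.+1 -> F}.

(* Fixed representatives of the points of P^m(F_q): the nonzero vectors whose
   first nonzero coordinate equals 1. *)
Definition proj_pts : {set vec} :=
  [set v : vec | [exists i : 'I_m.+1,
                   (v i == 1) && [forall j : 'I_m.+1, (j < i)%N ==> (v j == 0)]]].

Definition nzeros (r : nat) (f : 'I_r -> {mpoly F[m.+1]}) : nat :=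
  #|[set v in proj_pts | [forall k : 'I_r, (f k).@[v] == 0]]|.

Definition lin_indep (r : nat) (f : 'I_r -> {mpoly F[m.+1]}) : Prop :=
  forall c : 'I_r -> F, \sum_(k < r) c k *: f k = 0 -> forall k, c k = 0.

Definition is_e_r (d r e : nat) : Prop :=
  (exists f : 'I_r -> {mpoly F[m.+1]},
      (forall k, f k \is d.-homog) /\ lin_indep f /\ nzeros f = e)
  /\ (forall f : 'I_r -> {mpoly F[m.+1]},
      (forall k, f k \is d.-homog) -> lin_indep f -> (nzeros f <= e)%N).

Definition Npts : nat := #|proj_pts|.

Definition ev (p : {mpoly F[m.+1]}) : 'rV[F]_Npts :=
  \row_(j < Npts) p.@[enum_val j].

Definition PRM (d : nat) : 'rV[F]_Npts -> Prop :=
  fun c => exists p : {mpoly F[m.+1]}, p \is d.-homog /\ c = ev p.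

End Proj.

Definition supp (F : finFieldType) (N : nat) (D : {vspace 'rV[F]_N}) : {set 'I_N} :=
  [set i : 'I_N | [exists c : 'rV[F]_N, (c \in D) && (c 0 i != 0)]].

Definition is_ghw (F : finFieldType) (N : nat) (C : 'rV[F]_N -> Prop) (r w : nat) : Prop :=
  (exists D : {vspace 'rV[F]_N},
      \dim D = r /\ (forall c, c \in D -> C c) /\ #|supp D| = w)
  /\ (forall D : {vspace 'rV[F]_N},
      \dim D = r -> (forall c, c \in D -> C c) -> (w <= #|supp D|)%N).

(* Main.v *)
(* Let H_X(d) be the rank of the evaluation map of degree-d forms on a finite
   point set X.  Since r independent forms vanishing on X force
   H_X(d) <= C(m+d,d) - r = C(j+d,d) + t with j = m - i, the upper bound says that
   p_j + s points with s <= d < q satisfy H_X(d) >= C(j+d,d) + s.  Averaging over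
   all hyperplanes yields one that contains at most p_(j-1) points of X, so some
   affine chart contains a set Y of at least q^j + s points of X.  For an affine
   set Y, H_Y(d) is at least the number of x < |Y| whose base-q digit sum is at
   most d: slice Y by a pencil of parallel hyperplanes, taken in the order of
   decreasing number of points, and use that the k-th slice may be tested with
   forms of degree d - k only.  This reduces to a numerical inequality, which an
   induction on the lowest digit further reduces to a comparison of a Young
   diagram with the row-by-row filling of a q x q square.
   Conversely, the forms vanishing on P^j(F_q) and on t more points form a space
   of dimension at least r, and the upper bound shows that they have no further
   common zeros. *)
Require Import Defs.
From HB Require Import structures.
From mathcomp Require Import all_boot all_order all_algebra all_field.
From mathcomp Require Import mpoly zify.
Set Implicit Arguments. Unset Strict Implicit. Unset Printing Implicit Defensive.
Import Order.TTheory GRing.Theory.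

(** * Young diagrams in a square *)

(** Deleting the zero term [Q k] and moving the later terms one place down matches [Q] termwise with
    the first [n.-1] terms of [P]. *)
Lemma sum_shift_le (P Q : nat -> nat) (k n : nat) :
  k < n -> Q k = 0 -> (forall i, i < k -> Q i <= P i) ->
  (forall i, k <= i -> i.+1 < n -> Q i.+1 <= P i) ->
  \sum_(i < n) Q i <= \sum_(i < n.-1) P i.
Proof.
move=> ltkn Qk0 QP; elim: n ltkn => // n IHn ltkn QSP /=.
move: ltkn; rewrite ltnS leq_eqVlt => /predU1P[<-|ltkn].
  by rewrite big_ord_recr /= Qk0 addn0; apply: leq_sum => i _; apply: QP.
case: n IHn ltkn QSP => // n IHn ltkn QSP.
rewrite big_ord_recr [leqRHS]big_ord_recr /=.
apply: leq_add; first by apply: IHn => // i ? ?; apply: QSP; lia.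
by apply: QSP; lia.
Qed.

(** The terms of [Q] with index 1 to [k], moved one place down, and those with index from [k] on fit
    together under [P]; thus [Q k] is counted twice. *)
Lemma sum_shift_lt (P Q : nat -> nat) (k n : nat) :
  k < n -> Q 0 = 0 -> (forall i, i < k -> Q i.+1 <= P i) ->
  (forall i, k <= i < n -> Q i <= P i) ->
  \sum_(i < n) Q i + Q k <= \sum_(i < n) P i.
Proof.
move=> ltkn Q0 QSP; elim: n ltkn => // n IHn ltkn QP.
move: ltkn; rewrite ltnS leq_eqVlt => /predU1P[eqkn|ltkn].
  rewrite [leqRHS]big_ord_recr /= leq_add //; last by rewrite eqkn QP //; lia.
  rewrite big_ord_recl /= Q0 add0n; apply: leq_sum => i _.
  by apply: QSP; rewrite eqkn.
rewrite big_ord_recr [leqRHS]big_ord_recr /= addnAC.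
apply: leq_add; last by apply: QP; lia.
by apply: IHn => // i ?; apply: QP; lia.
Qed.

Lemma sum_pred_le (P : nat -> nat) (n : nat) :
  \sum_(i < n.-1) P i <= \sum_(i < n) P i.
Proof. by case: n => //= n; rewrite [leqRHS]big_ord_recr leq_addr. Qed.

Lemma sum_ltn_min (g n : nat) : \sum_(k < n) ((k < g) : nat) = minn g n.
Proof.
elim: n => [|n IHn]; first by rewrite big_ord0 minn0.
by rewrite big_ord_recr /= IHn; lia.
Qed.

Section Antidiagonals.
Variable q : nat.

(** The diagram has the cells [(x, y)] with [x < lam y]; those with [x + y = l] are counted. *)
Definition antidiag (lam : nat -> nat) (l : nat) : nat :=
  \sum_(y < q) ((y <= l < y + lam y) : nat).

Lemma sum_antidiag (lam : nat -> nat) (w : nat) :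
  \sum_(l < w) antidiag lam l = \sum_(y < q) minn (lam y) (w - y).
Proof.
rewrite exchange_big /=; apply: eq_bigr => y _.
elim: w => [|w IHw]; first by rewrite big_ord0; lia.
by rewrite big_ord_recr /= IHw; lia.
Qed.

Lemma antidiag_le (lam : nat -> nat) (l : nat) : antidiag lam l <= l.+1.
Proof.
apply: (@leq_trans (\sum_(y < q) ((y < l.+1) : nat))).
  by apply: leq_sum => y _; lia.
by rewrite sum_ltn_min geq_minl.
Qed.

Definition row_fill (N y : nat) : nat := minn q (N - y * q).

Lemma sum_row_fill (N k : nat) : \sum_(y < k) row_fill N y = minn N (k * q).
Proof.
elim: k => [|k IHk]; first by rewrite big_ord0; lia.
by rewrite big_ord_recr /= IHk /row_fill; lia.
Qed.

Section Nonincreasing.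
Variable lam : nat -> nat.
Hypothesis lam_anti : forall x y, x <= y < q -> lam y <= lam x.
Hypothesis lam_le : forall y, lam y <= q.

(** An antidiagonal that is not full misses some row [k]. Cells of the next one move left in the
    rows before [k] and to the preceding row after [k]; row [k] has none. *)
Lemma antidiag_leS (l : nat) :
  l < q -> antidiag lam l <= l -> antidiag lam l.+1 <= antidiag lam l.
Proof.
move=> ltlq small.
have [k lekl gapk] : exists2 k, k <= l & k + lam k <= l.
  case: (boolP [exists k : 'I_q, (k <= l) && (k + lam k <= l)]).
    by case/existsP=> k /andP[? ?]; exists k.
  rewrite negb_exists => /forallP nogap; suff: l < antidiag lam l by lia.
  rewrite /antidiag (leq_trans (n := \sum_(y < q) ((y < l.+1) : nat))) //.
    by rewrite sum_ltn_min; lia.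
  by apply: leq_sum => y _; have := nogap y; lia.
apply: (@leq_trans (\sum_(i < q.-1) ((i <= l < i + lam i) : nat))).
  apply: (sum_shift_le (k := k) (Q := fun y => y <= l.+1 < y + lam y)
    (P := fun y => y <= l < y + lam y)).
  - lia.
  - lia.
  - by move=> i ?; lia.
  - by move=> i ? ?; have := @lam_anti i i.+1; lia.
exact: (sum_pred_le (fun i => i <= l < i + lam i)).
Qed.

(** Antidiagonal [l.+1] no longer meets row 0. If it meets row [k], the cell there can move both
    left and to the preceding row, which yields one cell more on antidiagonal [l]. *)
Lemma antidiag_ltS (l : nat) :
  q <= l.+1 -> antidiag lam l.+1 <= (antidiag lam l).-1.
Proof.
move=> leql; have [->|] := posnP (antidiag lam l.+1); first by [].
rewrite lt0n sum_nat_eq0 negb_forall => /existsP[k]; rewrite /= eqb0 negbK => memk.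
have ltkq := ltn_ord k; suff: antidiag lam l.+1 < antidiag lam l by lia.
have := @sum_shift_lt (fun y => (y <= l < y + lam y))
  (fun y => (y <= l.+1 < y + lam y)) k q ltkq.
rewrite memk addn1; apply.
- by have := lam_le 0; lia.
- by move=> i ik; have := @lam_anti i i.+1; lia.
- by move=> i ik; lia.
Qed.

(** Here [b] counts the full rows that meet antidiagonal [l] inside the square; the partially filled
    row adds at most one cell. *)
Lemma antidiag_row_fill (N l : nat) :
  N <= q * q ->
  let b := minn l.+1 (N %/ q) - (l.+1 - q) in
  b <= antidiag (row_fill N) l <= b.+1.
Proof.
move=> leN /=; have [q0|q0] := posnP q.
  by rewrite /antidiag big1 => [|y _]; [lia | have := ltn_ord y; lia].
set r := N %/ q; have EN := divn_eq N q; have Lc := ltn_pmod N q0.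
have lerq : r <= q by rewrite -[leqRHS](mulnK q q0) leq_div2r.
rewrite -/r in EN; have Er y : row_fill N y = if y < r then q else if y == r then N %% q else 0.
  rewrite /row_fill; case: ltnP => [?|?]; first by nia.
  by case: eqP => [->|?]; nia.
have Eb : \sum_(y < q) ((y < minn l.+1 r) && (l.+1 - q <= y) : nat) = minn l.+1 r - (l.+1 - q).
  have -> : forall k, \sum_(y < k) ((y < minn l.+1 r) && (l.+1 - q <= y) : nat)
     = minn k (minn l.+1 r) - (l.+1 - q).
    elim=> [|k IHk]; first by rewrite big_ord0; lia.
    by rewrite big_ord_recr /= IHk; lia.
  lia.
have Ed : forall k, \sum_(y < k) ((y : nat) == r : nat) = (r < k).
  elim=> [|k IHk]; first by rewrite big_ord0.
  by rewrite big_ord_recr /= IHk; lia.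
rewrite -Eb; apply/andP; split.
  apply: leq_sum => y _; rewrite Er; have := ltn_ord y.
  by case: (ltnP y r) => ?; [|case: (_ =P r) => ?]; lia.
apply: (@leq_trans (\sum_(y < q)
    (((y < minn l.+1 r) && (l.+1 - q <= y) : nat) + ((y : nat) == r)))).
  apply: leq_sum => y _; rewrite Er; have := ltn_ord y.
  by case: (ltnP y r) => ?; [|case: (_ =P r) => ?]; lia.
by rewrite big_split /= Ed; lia.
Qed.

(** On [l0] the filling has at most [b.+1] cells, so [lam] has at most [b]. Up to the main
    antidiagonal [lam] does not grow, and from there it loses a cell per step until none is left,
    whereas the lower bound [b] for the filling falls by at most one per step, and only there. *)
Lemma antidiag_cross (N l0 l : nat) :
  N <= q * q -> antidiag lam l0 < antidiag (row_fill N) l0 -> l0 <= l ->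
  antidiag lam l <= antidiag (row_fill N) l.
Proof.
move=> leN ltl0 le0l; have /andP[_ B0] := antidiag_row_fill l0 leN.
have /andP[B1 _] := antidiag_row_fill l leN.
apply: leq_trans B1.
suff : antidiag lam l <= antidiag lam l0 - ((l.+1 - q) - (l0.+1 - q)) by lia.
rewrite -(subnK le0l) addnC; elim: (l - l0) => [|k IHk]; first by rewrite addn0; lia.
rewrite addnS; have [lek|ltk] := leqP q (l0 + k).+1.
  by have := antidiag_ltS lek; lia.
by have := antidiag_le (row_fill N) l0; have := @antidiag_leS (l0 + k); lia.
Qed.

(* Past the first antidiagonal on which [lam] has fewer cells than the
   row-by-row filling it never overtakes it again; as the totals agree, every
   prefix sum is at least that of the filling. *)
Lemma row_fill_linear (N w : nat) :
  \sum_(y < q) lam y = N ->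
  \sum_(y < q) minn (row_fill N y) (w - y) <= \sum_(y < q) minn (lam y) (w - y).
Proof.
move=> defN; have leN : N <= q * q.
  apply: (@leq_trans (\sum_(y < q) q)); first by rewrite -defN leq_sum.
  by rewrite sum_nat_const card_ord.
rewrite -!sum_antidiag leqNgt; apply/negP => lt_w.
have [l0 ltl0] : exists l0 : 'I_w, antidiag lam l0 < antidiag (row_fill N) l0.
  apply/existsP; apply: contraLR lt_w; rewrite negb_exists => /forallP ge.
  by rewrite -leqNgt; apply: leq_sum => l _; rewrite leqNgt ge.
(* The first [w + q.*2] antidiagonals cover the whole square, so both sums equal the number [N] of
   cells and cannot differ. *)
have : \sum_(l < w + q.*2) antidiag lam l < \sum_(l < w + q.*2) antidiag (row_fill N) l.
  rewrite !big_split_ord /= -addSn leq_add // leq_sum // => l _.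
  by apply: (antidiag_cross leN ltl0); have := ltn_ord l0; lia.
rewrite !sum_antidiag ltnNge => /negP; apply.
rewrite (eq_bigr (fun y : 'I_q => row_fill N y)) => [|y _]; last first.
  by rewrite /row_fill; have := ltn_ord y; lia.
rewrite sum_row_fill (eq_bigr (fun y : 'I_q => lam y)) => [|y _]; first by rewrite defN; lia.
by have := lam_le y; have := ltn_ord y; lia.
Qed.

(* The general weight [g] is compared with the linear one [y |-> w - y] that
   agrees with it on the last, partially filled row. *)
Lemma row_fill_le (g : nat -> nat) (N : nat) :
  (forall y, g y <= (g y.+1).+1) ->
  \sum_(y < q) lam y = N ->
  \sum_(y < q) minn (row_fill N y) (g y) <= \sum_(y < q) minn (lam y) (g y).
Proof.
move=> gS defN; have [q0|q0] := posnP q; first by rewrite big1 // => y _; have := ltn_ord y; lia.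
set r := N %/ q; pose w := g r + r.
have EN := divn_eq N q; have Lc := ltn_pmod N q0; rewrite -/r in EN.
have g_gt y k : g y <= g (y + k) + k.
  elim: k => [|k IHk]; first by rewrite !addn0.
  by rewrite !addnS; have := gS (y + k); lia.
(* Rows before [r] are full in the filling and have [g y <= w - y]; rows after [r] are empty and
   have [w - y <= g y]. Either way, replacing [g y] by [w - y] adds at least as much for the filling
   as for [lam]. *)
have row y : minn (row_fill N y) (g y) + minn (lam y) (w - y)
          <= minn (lam y) (g y) + minn (row_fill N y) (w - y).
  have [lt|gt|->] := ltngtP y r; last by rewrite /w addnK; lia.
    have -> : row_fill N y = q by rewrite /row_fill; nia.
    by have := g_gt y (r - y); rewrite subnKC ?(ltnW lt) // /w; have := lam_le y; lia.
  have -> : row_fill N y = 0 by rewrite /row_fill; nia.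
  by have := g_gt r (y - r); rewrite subnKC ?(ltnW gt) // /w; lia.
have lin := row_fill_linear w defN.
rewrite -(leq_add2r (\sum_(y < q) minn (lam y) (w - y))).
apply: leq_trans (leq_add (leqnn _) lin).
by rewrite -!big_split /=; apply: leq_sum => y _; apply: row.
Qed.

End Nonincreasing.
End Antidiagonals.

(** * Digit sums *)

Section DigitSums.
Variable q : nat.
Hypothesis q_gt0 : 0 < q.

Fixpoint dsum (p x : nat) : nat :=
  if p is p'.+1 then x %% q + dsum p' (x %/ q) else 0.

(** The strict bound [e] stands for degree [e - 1], in line with the shifted Hilbert function [hilb]
    below. *)
Definition nlow (p e N : nat) : nat := \sum_(x < N) ((dsum p x < e) : nat).

(* The number of [y] with [y * q + l < N], for [l < q]. *)
Definition nclass (N l : nat) : nat := N %/ q + (l < N %% q).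

Lemma dvdn_succ_mod (x : nat) : (q %| x.+1) = ((x %% q).+1 == q).
Proof.
rewrite {1}(divn_eq x q) -addnS dvdn_addr ?dvdn_mull //.
apply/idP/eqP => [dv|->]; last exact: dvdnn.
by apply/eqP; rewrite eqn_leq ltn_pmod //= dvdn_leq.
Qed.

Lemma dsumS (p x : nat) : dsum p x.+1 <= (dsum p x).+1.
Proof.
elim: p x => //= p IHp x.
rewrite modnS divnS // dvdn_succ_mod; case: eqP => _; last by rewrite add0n.
by rewrite add1n add0n (leq_trans (IHp _)) // ltnS leq_addl.
Qed.

Lemma nclassS (N l : nat) : l < q -> nclass N.+1 l = nclass N l + (l == N %% q).
Proof.
move=> ltlq; rewrite /nclass modnS divnS // dvdn_succ_mod.
by have := ltn_pmod N q_gt0; case: eqP => /=; lia.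
Qed.

(** The numbers with lowest digit [l] correspond, after removal of that digit, to an initial segment
    of length [nclass N l], with [e - l] left for the other digits. *)
Lemma nlowS (p e N : nat) :
  nlow p.+1 e N = \sum_(l < q) nlow p (e - l) (nclass N l).
Proof.
elim: N => [|N IHN].
  by rewrite /nlow big_ord0 big1 // => l _; rewrite /nclass div0n mod0n big_ord0.
have ltN := ltn_pmod N q_gt0.
rewrite {1}/nlow big_ord_recr /= -/(nlow p.+1 e N) IHN.
rewrite (bigD1 (Ordinal ltN)) // [RHS](bigD1 (Ordinal ltN)) //= addnAC.
congr (_ + _); last first.
  by apply: eq_bigr => l /negPf neq; rewrite nclassS // -val_eqE /= in neq *; rewrite neq addn0.
rewrite nclassS // eqxx addn1 {2}/nlow big_ord_recr /= -/(nlow _ _ _).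
by congr (_ + _); rewrite /nclass ltnn addn0; lia.
Qed.

Lemma leq_nlow (p e M N : nat) : M <= N -> nlow p e M <= nlow p e N.
Proof.
by move=> /subnK<-; rewrite addnC /nlow big_split_ord leq_addr.
Qed.

Lemma sum_nclass (N : nat) : \sum_(l < q) nclass N l = N.
Proof.
rewrite big_split /= sum_nat_const card_ord sum_ltn_min.
by rewrite (minn_idPl (ltnW (ltn_pmod N q_gt0))) mulnC -divn_eq.
Qed.

Lemma nclass_anti (N k l : nat) : k <= l -> nclass N l <= nclass N k.
Proof. by rewrite /nclass; lia. Qed.

Lemma nclass_mono (M N l : nat) : M <= N -> nclass M l <= nclass N l.
Proof.
move=> leMN; rewrite /nclass; have := leq_div2r q leMN.
rewrite leq_eqVlt => /predU1P[E|]; last by lia.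
by have := divn_eq M q; have := divn_eq N q; rewrite E; lia.
Qed.

Lemma nclass_leX (N p l : nat) : N <= q ^ p.+1 -> nclass N l <= q ^ p.
Proof.
move=> leN; rewrite expnSr in leN; have := nclass_mono l leN.
by rewrite {2}/nclass mulnK // modnMl ltn0 addn0.
Qed.

(** As [n] is nonincreasing, the [l] with [y < n l] form an initial segment, so intersecting with
    [l < g] leaves the shorter of two segments. *)
Lemma sum_downset_min (n : nat -> nat) (y g : nat) :
  (forall k l, k <= l < q -> n l <= n k) -> g <= q ->
  \sum_(l < q) ((y < n l) && (l < g) : nat) = minn (\sum_(l < q) ((y < n l) : nat)) g.
Proof.
move=> n_anti legq; pose L k := \sum_(l < k) ((y < n l) : nat).
have Lle k : L k <= k.
  by elim: k => [|k]; rewrite /L ?big_ord0 // big_ord_recr /=; lia.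
suff H k : k <= q -> (forall l, l < k -> (y < n l) = (l < L k)) /\
  \sum_(l < k) ((y < n l) && (l < g) : nat) = minn (L k) g.
  by have [_ ->] := H q (leqnn q); rewrite /L; lia.
elim: k => [_|k IHk ltkq]; first by rewrite /L !big_ord0; split=> //; lia.
have [memk sumk] := IHk (ltnW ltkq).
have LS : L k.+1 = L k + (y < n k) by rewrite /L big_ord_recr.
have full : y < n k -> L k = k.
  move=> yk; have [ltL|gt|//] := ltngtP (L k) k; last by have := Lle k; lia.
  by have := memk _ ltL; have := @n_anti (L k) k; lia.
split=> [l ltlk|].
  rewrite LS; have [l_k|gt|->] := ltngtP l k; last 2 first.
  - by lia.
  - by case: (ltnP y (n k)) full => [_ ->|_ _] //; have := Lle k; lia.
  by rewrite memk //; case: (ltnP y (n k)) full => [_ ->|_ _] //; lia.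
rewrite big_ord_recr /= sumk LS.
by case: (ltnP y (n k)) full => [_ ->|_ _] //; have := Lle k; lia.
Qed.

Lemma nlowD (p e S n : nat) :
  nlow p e (S + n) = nlow p e S + \sum_(y < n) ((dsum p (S + y) < e) : nat).
Proof. by rewrite /nlow big_split_ord. Qed.

(** The surplus over the common size [S] is a Young diagram with columns [n l]. Counted by rows, the
    digit sum condition becomes [l < e - dsum p (S + y)]. *)
Lemma sum_nlow_rows (p e S : nat) (n : nat -> nat) :
  (forall k l, k <= l < q -> n l <= n k) -> (forall l, l < q -> n l <= q) -> e <= q ->
  \sum_(l < q) nlow p (e - l) (S + n l) =
  \sum_(l < q) nlow p (e - l) S +
  \sum_(y < q) minn (\sum_(l < q) ((y < n l) : nat)) (e - dsum p (S + y)).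
Proof.
move=> n_anti n_le leeq.
under eq_bigr do rewrite nlowD; rewrite big_split /=; congr (_ + _).
transitivity (\sum_(l < q) \sum_(y < q) ((y < n l) && (l < e - dsum p (S + y)) : nat)).
  apply: eq_bigr => l _.
  rewrite (big_ord_widen q (fun y => (dsum p (S + y) < e - l) : nat)) ?n_le //.
  rewrite big_mkcond /=; apply: eq_bigr => y _.
  by case: (y < n l) => //=; congr (nat_of_bool _); lia.
rewrite exchange_big /=; apply: eq_bigr => y _.
by rewrite (sum_downset_min _ n_anti) //; lia.
Qed.

Lemma sum_ltn_nat (a k : nat) : a <= k -> \sum_(y < k) ((y < a) : nat) = a.
Proof. by move=> ?; rewrite sum_ltn_min; lia. Qed.

(** The surplus of the slices over the smallest one, [S], is a Young diagram in a [q] by [q] square.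
    Sorting the left side by lowest digit gives the row-by-row filling with equally many cells. *)
Lemma nlow_slices_spread (p e : nat) (T : nat -> nat) :
  e <= q -> (forall k l, k <= l < q -> T l <= T k) -> T 0 <= T q.-1 + q ->
  nlow p.+1 e (\sum_(l < q) T l) <= \sum_(l < q) nlow p (e - l) (T l).
Proof.
move=> leeq T_anti spread; set S := T q.-1.
have leS l : l < q -> S <= T l by move=> ?; apply: T_anti; lia.
pose n l := T l - S; set M := \sum_(l < q) n l.
have n_anti k l : k <= l < q -> n l <= n k.
  by move=> /T_anti; rewrite /n; lia.
have n_le l : l < q -> n l <= q.
  by move=> ltlq; have := @T_anti 0 l; rewrite /n; lia.
have -> : \sum_(l < q) T l = S * q + M.
  rewrite /M mulnC -[q in q * S]card_ord -sum_nat_const -big_split /=.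
  by apply: eq_bigr => l _; rewrite subnKC ?leS.
rewrite (eq_bigr (fun l : 'I_q => nlow p (e - l) (S + n l))) => [|l _]; last first.
  by rewrite subnKC ?leS.
have Mle : M <= q * q.
  apply: (@leq_trans (\sum_(l < q) q)); first by apply: leq_sum => l _; apply: n_le.
  by rewrite sum_nat_const card_ord.
rewrite nlowS [leqLHS](eq_bigr (fun l : 'I_q =>
  nlow p (e - l) (S + nclass M l))) => [|l _]; last first.
  by rewrite /nclass divnMDl // modnMDl addnA.
rewrite !sum_nlow_rows //; first last.
- by move=> l _; have := @nclass_leX M 1 l; rewrite expnS expn1; apply.
- by move=> k l /andP[kl _]; apply: nclass_anti.
rewrite leq_add2l; set lam := fun y => \sum_(l < q) ((y < n l) : nat).
have rows (k : nat -> nat) : (forall l, l < q -> k l <= q) ->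
    \sum_(y < q) \sum_(l < q) ((y < k l) : nat) = \sum_(l < q) k l.
  move=> k_le; rewrite exchange_big /=; apply: eq_bigr => l _.
  by rewrite sum_ltn_nat // k_le.
(* The weight [e - dsum p (S + y)] drops by at most one per row, by [dsumS]. *)
have := @row_fill_le q lam _ _ (fun y => e - dsum p (S + y)) M _ (rows n n_le).
rewrite (eq_bigr (fun y : 'I_q =>
  minn (\sum_(l < q) ((y < nclass M l) : nat)) (e - dsum p (S + y)))).
  apply.
  - by move=> x y xy; apply: leq_sum => l _; lia.
  - move=> y; rewrite (leq_trans (n := \sum_(l < q) 1)) //; last by rewrite sum1_card card_ord.
    by apply: leq_sum => l _; lia.
  - by move=> y; have := dsumS p (S + y); rewrite addnS; lia.
move=> y _; congr (minn _ _); rewrite /row_fill /nclass.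
have EM := divn_eq M q; have ltM := ltn_pmod M q_gt0.
have [lt|gt|E] := ltngtP y (M %/ q).
- rewrite (eq_bigr (fun _ => 1)) => [|l _]; last by lia.
  by rewrite sum1_card card_ord; nia.
- rewrite big1 => [|l _]; last by lia.
  by nia.
- rewrite (eq_bigr (fun l : 'I_q => (l < M %% q) : nat)) => [|l _]; last by rewrite E; lia.
  by rewrite sum_ltn_min E; nia.
Qed.

(* Exchanging the slices with the classes modulo [q] of the lowest digit yields
   [q] new slices whose sizes differ by at most [q]. *)
Lemma nlow_slices (p e : nat) (N : nat -> nat) :
  e <= q -> (forall k l, k <= l < q -> N l <= N k) ->
  (forall k, k < q -> N k <= q ^ p) ->
  nlow p.+1 e (\sum_(k < q) N k) <= \sum_(k < q) nlow p (e - k) (N k).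
Proof.
elim: p e N => [|p IHp] e N leeq N_anti N_le.
  by apply: nlow_slices_spread => //; have := N_le 0; rewrite expn0; lia.
pose T l := \sum_(k < q) nclass (N k) l.
have -> : \sum_(k < q) N k = \sum_(l < q) T l.
  by rewrite /T exchange_big /=; apply: eq_bigr => k _; rewrite sum_nclass.
apply: (@leq_trans (\sum_(l < q) nlow p.+1 (e - l) (T l))).
  apply: nlow_slices_spread => // [k l /andP[kl _]|].
    by apply: leq_sum => i _; apply: nclass_anti.
  rewrite -[q in _ + q]card_ord -sum1_card -big_split /=.
  by apply: leq_sum => i _; rewrite /nclass; lia.
(* For a fixed digit [l] the sizes [nclass (N k) l] are again nonincreasing in [k] and at most
   [q ^ p], so the induction hypothesis applies to them. *)
apply: (@leq_trans (\sum_(l < q) \sum_(k < q) nlow p (e - l - k) (nclass (N k) l))).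
  apply: leq_sum => l _.
  apply: (IHp (e - l) (fun k => nclass (N k) l)) => [|k k' /N_anti|k /N_le].
  - by lia.
  - exact: nclass_mono.
  - exact: nclass_leX.
rewrite exchange_big /=; apply: leq_sum => k _; rewrite nlowS.
by apply: leq_sum => l _; rewrite subnAC.
Qed.

Lemma nlow_small (p e s : nat) : s <= e -> e <= q -> nlow p.+1 e s = s.
Proof.
move=> se eq; rewrite /nlow (eq_bigr (fun _ => 1)) => [|x _].
  by rewrite sum1_card card_ord.
have ltx := ltn_ord x; rewrite /= modn_small ?divn_small //; [|lia|lia].
suff -> : forall p', dsum p' 0 = 0 by lia.
by elim=> //= p' IH; rewrite mod0n div0n.
Qed.

Lemma bin_sum_pred (j e : nat) :
  \sum_(k < e.+1) 'C(j + k, k) = 'C(j + e.+1, e).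
Proof.
elim: e => [|e IHe]; first by rewrite big_ord_recr big_ord0 /= !bin0.
by rewrite big_ord_recr IHe /= [in RHS]addnS binS addnC.
Qed.

(** Class [l] of the lowest digit has [q ^ j + (l < s)] members, so the induction uses degree
    [d - l] with surplus 0 or 1; the binomials add up by the hockey-stick identity. *)
Lemma nlow_ge (p j d s : nat) :
  j < p -> s <= d < q -> 'C(j + d, d) + s <= nlow p d.+1 (q ^ j + s).
Proof.
elim: j p d s => [|j IHj] [//|p] d s ltjp /andP[sd dq].
  by rewrite add0n binn expn0 nlow_small.
rewrite nlowS; have ltsq : s < q by lia.
have Encl l : nclass (q ^ j.+1 + s) l = q ^ j + (l < s).
  by rewrite /nclass expnSr divnMDl // modnMDl divn_small ?modn_small // addn0.
under eq_bigr do rewrite Encl.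
have -> : 'C(j.+1 + d, d) + s = \sum_(l < d.+1) ('C(j + (d - l), d - l) + (l < s)).
  rewrite big_split /= sum_ltn_nat //; last lia.
  rewrite addSnnS -bin_sum_pred; congr (_ + _).
  by rewrite (reindex_inj rev_ord_inj) /=; apply: eq_bigr => l _; rewrite subSS.
rewrite (leq_trans (n := \sum_(l < d.+1) nlow p (d.+1 - l) (q ^ j + (l < s)))) //.
  apply: leq_sum => l _; have ltl := ltn_ord l; rewrite subSn //.
  by apply: IHj; lia.
rewrite (big_ord_widen q (fun l => nlow p (d.+1 - l) (q ^ j + (l < s)))) //.
by rewrite big_mkcond; apply: leq_sum => l _; case: ifP.
Qed.

End DigitSums.

(** * Hilbert functions of finite point sets *)

Local Open Scope ring_scope.

Section HilbertFunction.
Variables (F : finFieldType) (m : nat).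
Notation V := (vec F m).
Notation W := {ffun V -> F^o}.
Implicit Types (X Y : {set V}) (a h l : V) (d e : nat).

Definition pmul (g : V -> F) (f : W) : W := [ffun v => g v * f v].

Lemma pmul_is_linear g : linear (pmul g).
Proof.
by move=> c f f'; apply/ffunP => v; rewrite !ffunE /= mulrDr mulrCA.
Qed.
HB.instance Definition _ g := GRing.isLinear.Build F W W _ (pmul g) (pmul_is_linear g).

Definition restr X : 'End(W) := linfun (pmul (fun v => (v \in X)%:R)).

(** Values outside [X] are set to 0, so that the evaluation spaces of all point sets lie in the
    single space [W]. *)
Definition evalX X d (p : dhomog m.+1 F d) : W :=
  [ffun v : V => (v \in X)%:R * (p : {mpoly F[m.+1]}).@[v]].

Lemma evalX_is_linear X d : linear (@evalX X d).
Proof.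
move=> c p p'; apply/ffunP => v; rewrite !ffunE.
by rewrite (linearP (@mpoly_of_dhomog m.+1 F d)) mevalD mevalZ mulrDr mulrCA.
Qed.
HB.instance Definition _ X d :=
  GRing.isLinear.Build F (dhomog m.+1 F d) W _ (@evalX X d) (@evalX_is_linear X d).

Definition ev_space X d : {vspace W} := limg (linfun (@evalX X d)).

(* [hilb X d.+1] is the value at [d] of the Hilbert function of [X]; the shift
   makes the value at degree [-1] available as [hilb X 0 = 0]. *)
Definition hilb X e : nat := if e is d.+1 then \dim (ev_space X d) else 0%N.

Lemma mem_ev_space X d (f : W) :
  reflect (exists p : dhomog m.+1 F d, f = evalX X p) (f \in ev_space X d).
Proof.
apply: (iffP memv_imgP) => [[p _ ->]|[p ->]]; first by exists p; rewrite lfunE.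
by exists p; rewrite ?memvf // lfunE.
Qed.

Lemma restr_evalX X Y d (p : dhomog m.+1 F d) :
  X \subset Y -> restr X (evalX Y p) = evalX X p.
Proof.
move=> /subsetP sXY; apply/ffunP => v; rewrite lfunE !ffunE /= mulrA.
by case: (boolP (v \in X)) => [/sXY->|_]; rewrite ?mul1r ?mul0r.
Qed.

Lemma restr_ev_space X Y d :
  X \subset Y -> (restr X @: ev_space Y d)%VS = ev_space X d.
Proof.
move=> sXY; apply/vspaceP => f; apply/memv_imgP/mem_ev_space => [[g /mem_ev_space[p ->] ->]|[p ->]].
  by exists p; rewrite restr_evalX.
by exists (evalX Y p); [apply/mem_ev_space; exists p | rewrite restr_evalX].
Qed.

Lemma hilb_mono X Y e : X \subset Y -> (hilb X e <= hilb Y e)%N.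
Proof.
case: e => //= d sXY; rewrite -(restr_ev_space d sXY).
by rewrite -[leqRHS](limg_ker_dim (restr X)) leq_addl.
Qed.

Definition lform a (v : V) : F := \sum_i a i * v i.
Definition lpoly a : {mpoly F[m.+1]} := \sum_i a i *: 'X_i.
Definition lzeros a : {set V} := [set v | lform a v == 0].

Lemma lpoly_homog a : lpoly a \is 1.-homog.
Proof. by apply: rpred_sum => i _; rewrite rpredZ // dhomogX /= mdeg1. Qed.

Lemma meval_lpoly a (v : V) : (lpoly a).@[v] = lform a v.
Proof. by rewrite raddf_sum; apply: eq_bigr => i _ /=; rewrite mevalZ mevalXU. Qed.

(** Rank-nullity for the restriction to [X :&: lzeros a]: its kernel contains the products of
    [lform a] with forms of one degree less, and multiplication by [lform a] is injective on
    functions supported in [X :\: lzeros a]. *)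
Lemma hilb_split a X e :
  (hilb (X :&: lzeros a) e + hilb (X :\: lzeros a) e.-1 <= hilb X e)%N.
Proof.
case: e => [|[|d]] //=; first by rewrite addn0 (@hilb_mono _ _ 1) // subsetIl.
set U := ev_space X d.+1.
rewrite -(restr_ev_space d.+1 (subsetIl X (lzeros a))).
rewrite -(limg_ker_dim (restr (X :&: lzeros a)) U) addnC leq_add2r.
pose mula := linfun (pmul (lform a)).
rewrite -[leqLHS](@limg_dim_eq _ _ _ mula); last first.
  apply/eqP; rewrite -subv0; apply/subvP => f; rewrite memv_cap memv_ker memv0.
  case/andP=> /mem_ev_space[p ->] /eqP /ffunP f0; apply/eqP/ffunP => v.
  have := f0 v; rewrite lfunE !ffunE !inE /=.
  case: (lform a v =P 0) => [|/eqP nz]; first by rewrite mul0r.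
  by move/eqP; rewrite mulf_eq0 (negPf nz) => /eqP.
apply/dimvS/subvP => f /memv_imgP[g /mem_ev_space[p ->] ->].
have homp : lpoly a * p \is d.+1.-homog.
  exact: dhomogM (lpoly_homog a) (dhomog_is_dhomog p).
rewrite memv_cap memv_ker; apply/andP; split.
  apply/mem_ev_space; exists (DHomog homp); apply/ffunP => v.
  rewrite lfunE !ffunE /= mevalM meval_lpoly !inE.
  by case: (lform a v =P 0) => [->|_]; rewrite ?mul0r ?mulr0 //= mulrCA.
apply/eqP/ffunP => v; rewrite !lfunE !ffunE /= !inE.
by case: (lform a v =P 0) => [->|_]; rewrite ?mul0r ?mulr0 ?andbF //= mul0r.
Qed.

Lemma hilb_gt0 h Y d v : v \in Y -> lform h v != 0 -> (0 < hilb Y d.+1)%N.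
Proof.
move=> Yv hv /=; rewrite lt0n dimv_eq0; apply/eqP => E0.
have homh : lpoly h ^+ d \is d.-homog by rewrite -[X in X.-homog]mul1n dhomogMn ?lpoly_homog.
have : evalX Y (DHomog homh) \in ev_space Y d by apply/mem_ev_space; exists (DHomog homh).
rewrite E0 memv0 => /eqP/ffunP/(_ v); rewrite !ffunE /= Yv mul1r rmorphXn /= meval_lpoly.
by move/eqP; rewrite expf_eq0 (negPf hv) andbF.
Qed.

(** * Slicing by a pencil of hyperplanes *)

Section Slices.
Variables h l : V.

(** Where [lform h] does not vanish, this is the fibre over [c] of the affine coordinate
    [lform l / lform h]. *)
Definition slice Y (c : F) : {set V} := Y :&: lzeros [ffun i => l i - c * h i].

Lemma lform_slice c v : lform [ffun i => l i - c * h i] v = lform l v - c * lform h v.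
Proof.
rewrite /lform mulr_sumr -sumrB; apply: eq_bigr => i _.
by rewrite ffunE mulrBl mulrA.
Qed.

Lemma in_slice Y c v : (v \in slice Y c) = (v \in Y) && (lform l v == c * lform h v).
Proof. by rewrite !inE lform_slice subr_eq0. Qed.

(** Slices are peeled off one at a time by [hilb_split], at the cost of one degree per slice already
    removed. *)
Lemma hilb_slices (cs : seq F) Y e :
  uniq cs -> {in Y, forall v, lform h v != 0} ->
  (\sum_(k < size cs) hilb (slice Y (nth 0%R cs k)) (e - k) <= hilb Y e)%N.
Proof.
elim: cs Y e => [|c cs IHcs] Y e /=; first by rewrite big_ord0.
case/andP=> cNcs ucs hY; rewrite big_ord_recl /= subn0.
apply: leq_trans (hilb_split [ffun i => l i - c * h i] Y e).
rewrite leq_add2l; set Y' := _ :\: _.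
have sY'Y : Y' \subset Y by apply: subsetDl.
apply: leq_trans (IHcs Y' e.-1 ucs _); last by move=> v /(subsetP sY'Y)/hY.
apply: leq_sum => k _; rewrite /bump /= add1n -subn1 -subnDA add1n.
(* The later slices lose no point in [Y']: a common point would force two equal values in [c :: cs],
   since [lform h] does not vanish on [Y]. *)
rewrite (_ : slice Y _ = slice Y' (nth 0%R cs k)) //; apply/setP => v.
rewrite !in_slice; case: (lform l v =P _) => [E|_]; rewrite ?andbF // !andbT.
rewrite !inE lform_slice E -mulrBl mulf_eq0 subr_eq0.
case: (boolP (v \in Y)) => [/hY/negPf-> /=|_]; last by rewrite andbF.
by rewrite orbF andbT add0n; apply/esym; apply: contraNneq cNcs => <-; rewrite mem_nth.
Qed.

Lemma card_slices Y : {in Y, forall v, lform h v != 0} ->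
  (\sum_(c : F) #|slice Y c| = #|Y|)%N.
Proof.
move=> hY; rewrite -[RHS]sum1_card.
rewrite (partition_big (fun v => lform l v / lform h v) xpredT) //=.
apply: eq_bigr => c _; rewrite -sum1_card; apply: eq_bigl => v; rewrite in_slice.
case: (boolP (v \in Y)) => //= /hY nz.
by rewrite (can2_eq (divfK nz) (mulfK nz)).
Qed.

End Slices.

(** The affine coordinates [lform l / lform h] determine the points of [Y]; cross-multiplication
    avoids the division. *)
Definition separates h (ls : seq V) Y := forall v w, v \in Y -> w \in Y ->
  (forall l, l \in ls -> lform l v * lform h w = lform l w * lform h v) -> v = w.

Lemma separates_slice h l ls Y c :
  separates h (l :: ls) Y -> separates h ls (slice h l Y c).
Proof.
move=> sep v w; rewrite !in_slice => /andP[Yv /eqP lv] /andP[Yw /eqP lw] sep'.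
apply: sep => // l'; rewrite inE => /predU1P[->|/sep' //].
by rewrite lv lw mulrAC.
Qed.

Lemma card_separated h ls Y : {in Y, forall v, lform h v != 0} ->
  separates h ls Y -> (#|Y| <= #|F| ^ size ls)%N.
Proof.
elim: ls Y => [|l ls IHls] Y hY sep /=.
  rewrite expn0; case: (set_0Vmem Y) => [->|[v Yv]]; first by rewrite cards0.
  rewrite -(cards1 v) subset_leq_card //; apply/subsetP => w Yw.
  by rewrite inE; apply/eqP/sep.
rewrite -(card_slices l hY) expnS -sum_nat_const; apply: leq_sum => c _.
apply: IHls; last exact: separates_slice sep.
by move=> v; rewrite in_slice => /andP[/hY].
Qed.

Lemma hilb_affine h ls Y e : (e <= #|F|)%N -> {in Y, forall v, lform h v != 0} ->
  separates h ls Y -> (nlow #|F| (size ls) e #|Y| <= hilb Y e)%N.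
Proof.
elim: ls Y e => [|l ls IHls] Y e leeq hY sep.
  (* Without coordinates [Y] has at most one point, and a power of [h] does not vanish there. *)
  have := card_separated hY sep; rewrite /= expn0.
  case: (set_0Vmem Y) => [->|[v Yv]]; first by rewrite cards0 /nlow big_ord0.
  have : (0 < #|Y|)%N by rewrite (cardD1 v) Yv.
  case: #|Y| => [|[]] // _ _; rewrite /nlow big_ord1 /=.
  by case: e leeq => // e _; rewrite (hilb_gt0 e Yv (hY v Yv)).
have q_gt0 : (0 < #|F|)%N by rewrite (cardD1 0).
(* Larger slices come first, hence are tested in higher degree, as [nlow_slices] requires. *)
pose size_le (c c' : F) := (#|slice h l Y c'| <= #|slice h l Y c|)%N.
pose cs := sort size_le (enum F).
have size_cs : size cs = #|F| by rewrite size_sort cardT.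
have hYs c : {in slice h l Y c, forall v, lform h v != 0}.
  by move=> v; rewrite in_slice => /andP[/hY].
pose N k := #|slice h l Y (nth 0%R cs k)|.
have sumN : (\sum_(k < #|F|) N k = #|Y|)%N.
  rewrite -(card_slices l hY) -(big_mkord xpredT N) -{1}size_cs.
  rewrite -(big_nth 0 xpredT (fun c => #|slice h l Y c|)).
  by rewrite (perm_big (enum F)) ?perm_sort // big_enum.
rewrite -sumN /=; apply: leq_trans (nlow_slices q_gt0 leeq _ _) _.
- move=> k k' /andP[le_k lt_k']; rewrite /N.
  apply: (sorted_leq_nth (leT := size_le)) => //.
  + by move=> x y z xy yz; apply: leq_trans yz xy.
  + by move=> x; apply: leqnn.
  + by apply: sort_sorted => x y; apply: leq_total.
  + by rewrite inE size_cs (leq_ltn_trans le_k).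
  + by rewrite inE size_cs.
- move=> k _; apply: card_separated (hYs _) _; exact: separates_slice sep.
apply: leq_trans (hilb_slices l (cs := cs) e _ hY); last by rewrite sort_uniq enum_uniq.
rewrite size_cs; apply: leq_sum => k _; apply: IHls => //.
  by rewrite (leq_trans (leq_subr _ _)).
exact: separates_slice sep.
Qed.

End HilbertFunction.

(** * Projective points *)

Lemma subset_of_card (T : finType) (A : {set T}) n :
  (n <= #|A|)%N -> exists2 B : {set T}, B \subset A & #|B| = n.
Proof.
case/card_geqP=> s [us <- sA]; exists [set x in s]; last by rewrite cardsE (card_uniqP us).
by apply/subsetP => x; rewrite inE => /sA.
Qed.

Lemma dim_dhomog (F : fieldType) n d : \dim {:dhomog n.+1 F d} = 'C(n + d, d).
Proof. by rewrite dimvf addnC. Qed.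

(** This is the number of points of a projective space of dimension [k - 1]; [k = 0] stands for the
    empty space. *)
Definition ptsum (q k : nat) : nat := \sum_(l < k) q ^ l.

Lemma ptsumS (q k : nat) : ptsum q k.+1 = (q * ptsum q k).+1.
Proof.
rewrite /ptsum big_ord_recl expn0 big_distrr /= add1n; congr _.+1.
by apply: eq_bigr => l _; rewrite -expnS.
Qed.

Section Points.
Variables (F : finFieldType) (m : nat).
Notation V := (vec F m).
Notation q := #|F|.
Notation pts := (proj_pts F m).
Implicit Types (X Y : {set V}) (a b h l v w : V) (d e k : nat).

Lemma proj_ptsP v :
  reflect (exists i, v i = 1 /\ forall j : 'I_m.+1, (j < i)%N -> v j = 0) (v \in pts).
Proof.
rewrite inE; apply: (iffP existsP) => -[i].
  case/andP=> /eqP vi /forallP v0; exists i; split=> // j ji.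
  by apply/eqP; have /implyP := v0 j; apply.
case=> vi v0; exists i; rewrite vi eqxx /=; apply/forallP => j.
by apply/implyP => /v0->.
Qed.

Definition unitv (i : 'I_m.+1) (c : F) : V := [ffun j => c *+ (j == i)].

Lemma lform_unitv i c v : lform (unitv i c) v = c * v i.
Proof.
rewrite /lform (bigD1 i) //= ffunE eqxx big1 ?addr0 // => j /negPf ji.
by rewrite ffunE ji mul0r.
Qed.

Definition vadd a b : V := [ffun j => a j + b j].

Lemma lformD a b v : lform (vadd a b) v = lform a v + lform b v.
Proof. by rewrite /lform -big_split; apply: eq_bigr => i _; rewrite ffunE mulrDl. Qed.

(** Adding multiples of the [i]-th coordinate form to annihilators of [v] is injective, since the
    value at [v] recovers the multiple. *)
Lemma card_annihilator v i : v i = 1 -> (#|[set a | lform a v == 0%R]| <= q ^ m)%N.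
Proof.
move=> vi; have q0 : (0 < q)%N by apply: ltnW (finNzRing_gt1 F).
rewrite -(leq_pmul2r q0) -expnSr; set A := [set a | _].
have inj : {in setX A [set: F] &, injective (fun ac => vadd ac.1 (unitv i ac.2))}.
  move=> [a c] [b c']; rewrite !inE !andbT /= => /eqP a0 /eqP b0 E.
  have := congr1 (fun a' => lform a' v) E; rewrite !lformD !lform_unitv.
  rewrite vi a0 b0 !add0r !mulr1 => Ec; rewrite Ec in E *; congr (_, _); apply/ffunP => j.
  by have /ffunP/(_ j) := E; rewrite !ffunE => /addIr.
have <- : #|setX A [set: F]| = (#|A| * q)%N by rewrite cardsX cardsT.
rewrite -(card_in_imset inj) (leq_trans (max_card _)) //.
by rewrite card_ffun card_ord.
Qed.

(** Double counting of the pairs of a form [h] and a point of [X] at which it vanishes: each point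
    occurs with at most [q ^ m] forms. *)
Lemma exists_sparse_hyperplane X u :
  X \subset pts -> (#|X| <= q * u.+1)%N -> exists h, (#|X :&: lzeros h| <= u)%N.
Proof.
move=> /subsetP sX leX; case: (boolP [exists h, #|X :&: lzeros h| <= u]%N).
  by case/existsP=> h; exists h.
rewrite negb_exists => /forallP big; exfalso.
have lf0 v : lform (unitv ord0 0) v = 0 by rewrite lform_unitv mul0r.
have up : (\sum_(h : V) #|X :&: lzeros h| <= #|X| * q ^ m)%N.
  rewrite (eq_bigr (fun h : V => \sum_(v in X) (lform h v == 0%R))%N) => [|h _]; last first.
    rewrite -sum1_card big_mkcond [RHS]big_mkcond /=; apply: eq_bigr => v _.
    by rewrite !inE; case: (v \in X) => //=; case: (_ == 0).
  rewrite exchange_big /= -sum_nat_const; apply: leq_sum => v /sX /proj_ptsP[i [vi _]].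
  rewrite (leq_trans _ (card_annihilator vi)) // -sum1_card big_mkcond [leqRHS]big_mkcond /=.
  by apply: leq_sum => h _; rewrite inE; case: (_ == 0).
have low : (#|X| + (q ^ m.+1).-1 * u.+1 <= \sum_(h : V) #|X :&: lzeros h|)%N.
  (* The zero form vanishes on all of [X]; every other form is assumed to vanish at [u.+1] points or
     more. *)
  rewrite (bigD1 (unitv ord0 0)) //= leq_add //.
    by rewrite subset_leq_card //; apply/subsetP => v Xv; rewrite !inE Xv lf0 eqxx.
  have -> : (q ^ m.+1).-1 = #|[pred h : V | h != unitv ord0 0]|.
    by rewrite (eq_card (B := predC1 (unitv ord0 0))) // cardC1 card_ffun card_ord.
  rewrite -sum_nat_const; apply: leq_sum => h _.
  by have := big h; rewrite -ltnNge.
have X0 : (u < #|X|)%N.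
  have := big (unitv ord0 0); rewrite -ltnNge => /leq_trans-> //.
  by rewrite subset_leq_card // subsetIl.
have := leq_trans low up; have qm : (0 < q ^ m)%N by rewrite expn_gt0 ltnW ?finNzRing_gt1.
have q2 := finNzRing_gt1 F; rewrite expnS.
have : (#|X| * q ^ m <= q * u.+1 * q ^ m)%N by rewrite leq_mul2r leX orbT.
move: X0 leX q2 qm; move: #|X| (q ^ m)%N => n Q; move: (#|F|) => q' *.
have : (q' * Q).-1 * u.+1 + u.+1 = q' * u.+1 * Q by nia.
have [|] := ltnP u.+1 n; first by lia.
by nia.
Qed.

(** Equal ratios make [v] and [w] proportional; their leading coordinates then have the same
    position, and both being 1 fixes the factor. *)
Lemma separates_proj_pts h Y : Y \subset pts -> {in Y, forall v, lform h v != 0} ->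
  separates h [seq unitv i 1 | i <- enum 'I_m.+1] Y.
Proof.
move=> /subsetP sY hY v w Yv Yw eqvw.
have {eqvw} prop i : v i * lform h w = w i * lform h v.
  have := eqvw (unitv i 1); rewrite !lform_unitv !mul1r; apply.
  by apply/mapP; exists i; rewrite ?mem_enum.
have /proj_ptsP[i [vi v0]] := sY _ Yv; have /proj_ptsP[j [wj w0]] := sY _ Yw.
have hv := hY _ Yv; have hw := hY _ Yw.
have [ij|ji|E] := ltngtP i j.
- by have := prop i; rewrite vi w0 // mul1r mul0r => /eqP; rewrite (negPf hw).
- by have := prop j; rewrite wj v0 // mul1r mul0r => /esym/eqP; rewrite (negPf hv).
have {}E : i = j by apply: val_inj.
have := prop i; rewrite vi E wj !mul1r => Eh; apply/ffunP => k.
by have := prop k; rewrite Eh => /(mulIf hv).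
Qed.

(* A hyperplane meeting [X] in few points leaves a large affine part. *)
Lemma hilb_proj_ge X k s d : (k <= m.+1)%N -> (0 < d < q)%N -> (s <= d)%N -> X \subset pts ->
  (ptsum q k + s <= #|X|)%N -> ('C(k + d - 1, d) + s <= hilb X d.+1)%N.
Proof.
move=> lekm /andP[d_gt0 ltdq] lesd sXp /subset_of_card[X0 sX0 cX0].
apply: leq_trans (hilb_mono _ sX0); have {sX0} sX0 := subset_trans sX0 sXp.
(* Since [s < q], the recursion for [ptsum] gives [ptsum q k + s <= q * u.+1], the size bound needed
   for averaging. *)
pose u := ptsum q k.-1; have q0 := ltnW (finNzRing_gt1 F).
have [h sparse] : exists h, (#|X0 :&: lzeros h| <= u)%N.
  apply: exists_sparse_hyperplane => //; rewrite cX0 /u; case: k {lekm cX0 u} => [|k] /=.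
    by rewrite /ptsum !big_ord0 add0n muln1 ltnW // (leq_ltn_trans lesd).
  by rewrite ptsumS mulnS addSnnS addnC leq_add2r (leq_ltn_trans lesd).
pose Y := X0 :\: lzeros h; have sY : Y \subset X0 by apply: subsetDl.
apply: leq_trans (hilb_mono _ sY).
have hY : {in Y, forall v, lform h v != 0} by move=> v; rewrite !inE => /andP[].
apply: leq_trans (hilb_affine ltdq hY (separates_proj_pts (subset_trans sY sX0) hY)).
have cY : (#|Y| + #|X0 :&: lzeros h| = ptsum q k + s)%N by rewrite addnC cardsID.
rewrite size_map size_enum_ord; case: k lekm @u cX0 sparse cY => [|k] lekm u cX0 sparse cY.
  (* For [k = 0] the hyperplane misses [X0], and all [s] points are counted by [nlow]. *)
  have -> : 'C(0 + d - 1, d) = 0%N by rewrite bin_small //; lia.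
  rewrite -[leqLHS](nlow_small q0 m _ ltdq) ?leq_nlow //; last by lia.
  by move: cY sparse; rewrite /u /= /ptsum !big_ord0; lia.
rewrite addSn subn1 /= (leq_trans (nlow_ge q0 (p := m.+1) _ _)) ?lesd //.
apply: leq_nlow; rewrite -(leq_add2r #|X0 :&: lzeros h|) cY.
rewrite {1}/ptsum big_ord_recr /= [(_ + q ^ k)%N]addnC -!addnA leq_add2l.
by rewrite addnC leq_add2r.
Qed.
End Points.

(** * Systems of forms *)

Lemma dhomog_comp (R : comNzRingType) (n k d : nat) (p : {mpoly R[n]})
    (lq : n.-tuple {mpoly R[k]}) :
  p \is d.-homog -> (forall i, tnth lq i \is 1.-homog) -> p \mPo lq \is d.-homog.
Proof.
move=> /dhomogP homp homlq; rewrite comp_mpolyE big_seq rpred_sum // => mu /homp <-.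
rewrite rpredZ //= mdegE; elim/big_ind2: _ => [|? ? ? ? ? ?|i _]; first exact: dhomog1.
  exact: dhomogM.
by have := dhomogMn (mu i) (homlq i); rewrite mul1n.
Qed.

Section Systems.
Variables (F : finFieldType) (m : nat).
Notation V := (vec F m).
Notation W := {ffun V -> F^o}.
Notation q := #|F|.
Notation pts := (proj_pts F m).
Notation S d := (dhomog m.+1 F d).
Implicit Types (X Y : {set V}) (v w : V) (d r : nat).

Lemma dim_vanishing X d :
  (\dim (lker (linfun (@evalX F m X d))) + hilb X d.+1 = 'C(m + d, d))%N.
Proof. by rewrite -[lker _]capfv limg_ker_dim dim_dhomog. Qed.

Lemma evalX_eq0 X d (p : S d) :
  evalX X p = 0 <-> {in X, forall v, (p : {mpoly F[m.+1]}).@[v] = 0}.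
Proof.
split=> [/ffunP p0 v Xv|p0]; first by have := p0 v; rewrite !ffunE Xv mul1r.
apply/ffunP => v; rewrite !ffunE; case: (boolP (v \in X)) => [/p0->|_].
  by rewrite mulr0.
by rewrite mul0r.
Qed.

Lemma lin_indep_free d r (g : 'I_r -> S d) :
  lin_indep (fun k => g k : {mpoly F[m.+1]}) <-> free [tuple g k | k < r].
Proof.
have val_sum c : val (\sum_(k < r) c k *: g k) = \sum_(k < r) c k *: (g k : {mpoly F[m.+1]}).
  by rewrite (raddf_sum (@mpoly_of_dhomog m.+1 F d)); apply: eq_bigr.
have nthE c : \sum_(i < r) c i *: [tuple g k | k < r]`_i = \sum_(k < r) c k *: g k.
  by apply: eq_bigr => i _; rewrite -tnth_nth tnth_mktuple.
split=> [ind|/freeP ind c c0].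
  by apply/freeP => c; rewrite nthE => c0; apply: ind; rewrite -val_sum c0.
by apply: ind; rewrite nthE; apply: val_inj; rewrite val_sum.
Qed.

Lemma vanishing_le X d r (f : 'I_r -> {mpoly F[m.+1]}) :
  (forall k, f k \is d.-homog) -> lin_indep f ->
  (forall k, {in X, forall v, (f k).@[v] = 0}) ->
  (r + hilb X d.+1 <= 'C(m + d, d))%N.
Proof.
move=> homf indf f0; pose g k : S d := DHomog (homf k).
rewrite -(dim_vanishing X d) leq_add2r.
have /eqP {1}<- : \dim <<[tuple g k | k < r]>> == r.
  have /(lin_indep_free g) : lin_indep (fun k => g k : {mpoly F[m.+1]}) by [].
  by rewrite /free size_tuple.
apply/dimvS/span_subvP => _ /mapP[k _ ->]; rewrite memv_ker lfunE.
by apply/eqP/evalX_eq0; apply: f0.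
Qed.

Lemma ex_vanishing X d r : (r + hilb X d.+1 <= 'C(m + d, d))%N ->
  exists g : 'I_r -> S d, lin_indep (fun k => g k : {mpoly F[m.+1]}) /\
    forall k, {in X, forall v, (g k : {mpoly F[m.+1]}).@[v] = 0}.
Proof.
set K := lker (linfun (@evalX F m X d)).
rewrite -(dim_vanishing X d) leq_add2r -/K => le_r.
exists (fun k => (vbasis K)`_(widen_ord le_r k)); split=> [|k].
  apply/lin_indep_free/freeP => c.
  under eq_bigr do rewrite -tnth_nth tnth_mktuple.
  move=> c0 k; have /(congr1 (coord (vbasis K) (widen_ord le_r k))) := c0.
  have cf (i : 'I_r) : coord (vbasis K) (widen_ord le_r k) (vbasis K)`_i = (i == k)%:R.
    exact: coord_free (widen_ord le_r i) (widen_ord le_r k) (basis_free (vbasisP K)).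
  rewrite linear_sum linear0 (bigD1 k) //= linearZ /= cf eqxx mulr1.
  by rewrite big1 ?addr0 // => i /negPf ik; rewrite linearZ /= cf ik mulr0.
apply/evalX_eq0; have : (vbasis K)`_(widen_ord le_r k) \in K.
  by apply: vbasis_mem; rewrite mem_nth ?size_tuple.
by rewrite memv_ker lfunE => /eqP.
Qed.

(** The kernel of the restriction to [X] consists of functions supported on [Y :\: X], which are
    spanned by one delta function per point. *)
Lemma hilb_card_add X Y d : X \subset Y ->
  (hilb Y d.+1 <= hilb X d.+1 + #|Y :\: X|)%N.
Proof.
move=> sXY; rewrite /= -(limg_ker_dim (restr X) (ev_space Y d)) restr_ev_space //.
rewrite addnC leq_add2l; pose delta v : W := [ffun w => (w == v)%:R].
pose D := [seq delta v | v <- enum (Y :\: X)].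
rewrite (@leq_trans (size D)) //; last by rewrite size_map -cardE.
apply: leq_trans (dim_span D); apply/dimvS/subvP => f.
rewrite memv_cap memv_ker => /andP[/mem_ev_space[p ->] /eqP/ffunP p0].
have -> : evalX Y p = \sum_(v in Y :\: X) evalX Y p v *: delta v.
  apply/ffunP => w; rewrite sum_ffunE.
  have E v : (evalX Y p v *: delta v) w = if v == w then evalX Y p v else 0.
    rewrite ffunE [delta v w]ffunE eq_sym; case: eqP => _; first by rewrite -[RHS]mulr1.
    by rewrite scaler0.
  under eq_bigr do rewrite E.
  rewrite -big_mkcondr /=; case: (boolP (w \in Y :\: X)) => wYX.
    by rewrite (big_pred1 w) // => v /=; case: eqP => [->|]; rewrite ?wYX ?andbF.
  rewrite big_pred0 => [|v]; last by case: eqP => [->|]; rewrite ?(negPf wYX) ?andbF.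
  have := p0 w; rewrite lfunE !ffunE; move: wYX; rewrite inE negb_and negbK.
  by case/orP=> [->|/negPf->]; rewrite ?mul1r // mul0r.
rewrite big_seq_cond rpred_sum // => v /andP[_ YXv]; rewrite rpredZ // memv_span //.
by apply: map_f; rewrite mem_enum.
Qed.

(* [linsp k] is the [(k-1)]-dimensional projective subspace spanned by the
   first [k] coordinate points. *)
Definition linsp k : {set V} :=
  [set v in pts | [forall i : 'I_m.+1, (k <= i)%N ==> (v i == 0)]].

Lemma linsp_sub k : linsp k \subset pts.
Proof. by apply/subsetP => v; rewrite inE => /andP[]. Qed.

Lemma linspT : linsp m.+1 = pts.
Proof.
apply/setP => v; rewrite inE; case: (v \in pts) => //=; apply/forallP => i.
by rewrite leqNgt ltn_ord.
Qed.

Definition echelon k (i : 'I_m.+1) : {set V} :=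
  [set v : V | [&& v i == 1, [forall j : 'I_m.+1, (j < i)%N ==> (v j == 0)]
    & [forall j : 'I_m.+1, (k <= j)%N ==> (v j == 0)]]].

Lemma sum_ord_between n (a b : nat) : (b <= n)%N ->
  (\sum_(j < n) (a < j < b) = b - a.+1)%N.
Proof.
move=> ?; have -> : forall n', (\sum_(j < n') (a < j < b) = minn b n' - a.+1)%N.
  elim=> [|n' IH]; first by rewrite big_ord0; lia.
  by rewrite big_ord_recr /= IH; lia.
by lia.
Qed.

Lemma card_echelon k (i : 'I_m.+1) : (i < k <= m.+1)%N ->
  #|echelon k i| = (q ^ (k - i.+1))%N.
Proof.
move=> /andP[ik km]; pose D := [pred j : 'I_m.+1 | i < j < k]%N.
have cardD : #|D| = (k - i.+1)%N.
  rewrite -(sum_ord_between i km) -sum1_card big_mkcond.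
  by apply: eq_bigr => j _; rewrite inE; case: ifP.
rewrite -cardD -(card_pffun_on (0 : F) D predT).
(* The coordinates strictly between [i] and [k] are free; [put] inserts the leading 1. *)
pose put (v : V) : V := [ffun j => if j == i then 1 else v j].
have D0 (v : V) j : v \in pffun_on (0 : F) D predT -> j \notin D -> v j = 0.
  by case/pffun_onP=> /supportP sup _ Dj; apply: sup.
have iD : i \notin D by rewrite inE ltnn.
rewrite -[RHS](card_in_imset (f := put)) => [|v w Dv Dw /ffunP E]; last first.
  apply/ffunP => j; have := E j; rewrite !ffunE.
  by case: eqP => // -> _; rewrite !D0.
apply: eq_card => v; apply/idP/imsetP => [|[w Dw ->]].
  rewrite inE => /and3P[/eqP vi /forallP v0 /forallP vk].
  exists [ffun j => if j == i then 0 else v j].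
    apply/pffun_onP; split=> //; apply/supportP => j; rewrite !inE ffunE.
    case: eqP => // /eqP ji; rewrite negb_and -!leqNgt => /orP[ji'|kj].
      apply/eqP; have /implyP := v0 j; apply.
      by rewrite ltn_neqAle ji' andbT; apply: contra ji.
    by apply/eqP; have /implyP := vk j; apply.
  by apply/ffunP => j; rewrite !ffunE; case: eqP => // ->.
rewrite inE ffunE eqxx eqxx /=; apply/andP.
split; apply/forallP => j; apply/implyP => jj; rewrite ffunE.
  by case: (j =P i) => [E|_]; [rewrite E ltnn in jj | rewrite D0 // inE ltnNge (ltnW jj)].
case: (j =P i) => [E|_]; first by rewrite E leqNgt ik in jj.
by rewrite D0 // inE [(j < k)%N]ltnNge jj andbF.
Qed.

Lemma card_linsp k : (k <= m.+1)%N -> #|linsp k| = ptsum q k.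
Proof.
move=> km.
have E v : ((v \in linsp k) : nat) = (\sum_(i < m.+1 | (i < k)%N) (v \in echelon k i))%N.
  case: (boolP (v \in linsp k)) => [|vNk]; last first.
    rewrite big1 // => i _; apply/eqP; rewrite eqb0; apply: contra vNk.
    rewrite !inE => /and3P[vi v0 ->]; rewrite andbT.
    by apply/existsP; exists i; rewrite vi.
  rewrite inE => /andP[/proj_ptsP[i [vi v0]] vk].
  have ik : (i < k)%N.
    rewrite ltnNge; apply/negP => ki; have /forallP/(_ i) := vk.
    by rewrite ki vi /= oner_eq0.
  rewrite (bigD1 i) //= big1 => [|j /andP[_ ji]].
    rewrite inE vi eqxx vk /= andbT (_ : [forall _, _]) //.
    by apply/forallP => j; apply/implyP => /v0->.
  apply/eqP; rewrite eqb0 inE; apply/negP => /and3P[/eqP vj /forallP vj0 _].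
  have [ltij|ltji|E] := ltngtP i j.
  - by have := vj0 i; rewrite ltij vi /= oner_eq0.
  - by have /eqP := v0 _ ltji; rewrite vj oner_eq0.
  - by case/eqP: ji; apply/esym/val_inj.
have -> : #|linsp k| = (\sum_(v : V) (v \in linsp k))%N.
  by rewrite -sum1_card big_mkcond; apply: eq_bigr => v _; case: ifP.
under eq_bigr do rewrite E.
rewrite exchange_big /= (eq_bigr (fun i : 'I_m.+1 => (q ^ (k - i.+1))%N)) => [|i ik]; last first.
  rewrite -(card_echelon (k := k)) ?ik //.
  by rewrite -sum1_card [RHS]big_mkcond; apply: eq_bigr => v _; case: ifP.
rewrite -(big_ord_widen m.+1 (fun i => q ^ (k - i.+1))%N) // /ptsum.
by rewrite (reindex_inj rev_ord_inj) /=; apply: eq_bigr => i _; rewrite subnSK // subKn // ltnW.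
Qed.

Lemma Npts_ptsum : Npts F m = ptsum q m.+1.
Proof. by rewrite -card_linsp // linspT. Qed.

(** On [linsp k] a form agrees with the form in [k] variables obtained by setting the other
    variables to 0, so the rank is at most the dimension of the space of such forms. *)
Lemma hilb_linsp k d : (0 < d)%N -> (k <= m.+1)%N ->
  (hilb (linsp k) d.+1 <= 'C(k + d - 1, d))%N.
Proof.
move=> d_gt0 km; case: k km => [|k] km.
  rewrite /= bin_small ?leqn0 ?dimv_eq0; last by lia.
  have -> : linsp 0 = set0 by apply/eqP; rewrite -cards_eq0 card_linsp // /ptsum big_ord0.
  rewrite -subv0; apply/subvP => f /mem_ev_space[p ->]; rewrite memv0.
  by apply/eqP/evalX_eq0 => v; rewrite inE.
pose ext (p : dhomog k.+1 F d) : W :=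
  [ffun v : V => (v \in linsp k.+1)%:R * (p : {mpoly F[k.+1]}).@[fun i => v (inord i)]].
have ext_lin : linear ext.
  move=> c p p'; apply/ffunP => v; rewrite !ffunE.
  by rewrite (linearP (@mpoly_of_dhomog k.+1 F d)) mevalD mevalZ mulrDr mulrCA.
pose extL := GRing.isLinear.Build F (dhomog k.+1 F d) W _ ext ext_lin.
pose extl : {linear dhomog k.+1 F d -> W} := HB.pack ext extL.
have le_ext : (\dim (limg (linfun extl)) <= 'C(k + d, d))%N.
  by rewrite -(dim_dhomog F k d) -[leqRHS](limg_ker_dim (linfun extl)) leq_addl.
rewrite addSn subn1; apply: leq_trans le_ext; apply/dimvS/subvP => f.
case/mem_ev_space=> p ->; pose lq : m.+1.-tuple {mpoly F[k.+1]} :=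
  [tuple if (i < k.+1)%N then 'X_(inord i) else 0 | i < m.+1].
have homlq i : tnth lq i \is 1.-homog.
  by rewrite tnth_mktuple; case: ifP => _; rewrite ?rpred0 // dhomogX /= mdeg1.
have homp := dhomog_comp (dhomog_is_dhomog p) homlq.
apply/memv_imgP; exists (DHomog homp); first exact: memvf.
rewrite lfunE; apply/ffunP => v; rewrite !ffunE /= comp_mpoly_meval.
case: (boolP (v \in linsp k.+1)) => [|_]; last by rewrite !mul0r.
rewrite inE => /andP[_ /forallP vk]; congr (_ * _); apply: meval_eq => i.
rewrite tnth_mktuple; case: ltnP => [ik|ki].
  by rewrite mevalXU; congr (v _); apply: val_inj; rewrite /= !inordK.
by rewrite meval0; have := vk i; rewrite ki => /eqP.
Qed.

End Systems.

(** * Numerical parameters *)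

(** Iterated Pascal rule. It turns [r] into the codimension form
    ['C(m + d, d) - 'C(k + d - 1, d) - t] with [k = m.+1 - i]. *)
Lemma sum_bin_hockey (m d i : nat) : (0 < d)%N -> (i <= m.+1)%N ->
  (\sum_(1 <= a < i.+1) 'C(m + d - a, d - 1) + 'C(m.+1 - i + d - 1, d) = 'C(m + d, d))%N.
Proof.
move=> d0; elim: i => [|i IHi] im.
  by rewrite big_geq // add0n subn0 addSn subn1.
rewrite big_nat_recr //= -(IHi (ltnW im)) -addnA; congr (_ + _)%N.
case: d d0 {IHi} => // d _.
have -> : (m.+1 - i + d.+1 - 1 = (m - i + d).+1)%N by lia.
have -> : (m.+1 - i.+1 + d.+1 - 1 = m - i + d)%N by lia.
have -> : (m + d.+1 - i.+1 = m - i + d)%N by lia.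
by rewrite binS subn1 addnC.
Qed.

Lemma pj_ptsum (q m i : nat) : (i <= m.+1)%N ->
  pj q (m%:Z - i%:Z) = ptsum q (m.+1 - i).
Proof.
rewrite leq_eqVlt => /predU1P[->|im].
  have -> : m%:Z - m.+1%:Z = Negz 0 by lia.
  by rewrite subnn /ptsum big_ord0.
have -> : m%:Z - i%:Z = (m - i)%N by lia.
by rewrite subSn.
Qed.

(** * Common zeros of systems and supports of subcodes *)

Section Codes.
Variables (F : finFieldType) (m : nat).
Notation V := (vec F m).
Notation q := #|F|.
Notation pts := (proj_pts F m).
Notation S d := (dhomog m.+1 F d).
Notation N := (Npts F m).

Definition czeros r (f : 'I_r -> {mpoly F[m.+1]}) : {set V} :=
  [set v in pts | [forall k : 'I_r, (f k).@[v] == 0]].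

(** One zero too many would allow [hilb_proj_ge] with [s = t.+1], which is at most [d]; the rank
    would then leave room for fewer than [r] forms. *)
Lemma nzeros_le (k d t r : nat) (f : 'I_r -> {mpoly F[m.+1]}) :
  (k <= m.+1)%N -> (0 < d < q)%N -> (t < d)%N ->
  (r + ('C(k + d - 1, d) + t) = 'C(m + d, d))%N ->
  (forall j, f j \is d.-homog) -> lin_indep f -> (nzeros f <= ptsum q k + t)%N.
Proof.
move=> km dq td Er homf indf; rewrite leqNgt; apply/negP; rewrite -addnS => lt_z.
have sZ : czeros f \subset pts by apply/subsetP => v; rewrite inE => /andP[].
have := hilb_proj_ge km dq td sZ lt_z.
have : (r + hilb (czeros f) d.+1 <= 'C(m + d, d))%N.
  by apply: vanishing_le homf indf _ => j v; rewrite inE => /andP[_ /forallP/(_ j)/eqP].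
by lia.
Qed.

Lemma ex_nzeros (k d t r : nat) : (0 < m)%N ->
  (k <= m)%N -> (0 < d < q)%N -> (t < d)%N ->
  (r + ('C(k + d - 1, d) + t) = 'C(m + d, d))%N ->
  exists g : 'I_r -> S d, lin_indep (fun j => g j : {mpoly F[m.+1]}) /\
    nzeros (fun j => g j : {mpoly F[m.+1]}) = (ptsum q k + t)%N.
Proof.
move=> m0 km /andP[d0 dq] td Er; have km1 := leqW km.
(* Outside [linsp k] there are at least [q ^ m] points, and [t < q <= q ^ m]. *)
have [B sB cB] : exists2 B : {set V}, B \subset pts :\: linsp F m k & #|B| = t.
  apply: subset_of_card; rewrite cardsD (setIidPr (linsp_sub F m k)) card_linsp //.
  rewrite -/(Npts F m) Npts_ptsum {1}/ptsum big_ord_recr /= -/(ptsum q m) -addnBAC; last first.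
    by rewrite /ptsum -(subnKC km) big_split_ord leq_addr.
  rewrite (leq_trans _ (leq_addl _ _)) //.
  rewrite (leq_trans (ltnW (ltn_trans td dq))) //.
  by case: m m0 => // m' _; rewrite expnS leq_pmulr // expn_gt0 (leq_trans _ dq).
pose X := linsp F m k :|: B.
have sLX : linsp F m k \subset X by apply: subsetUl.
have XDL : X :\: linsp F m k = B.
  apply/setP => v; rewrite in_setD in_setU; case: (boolP (v \in B)) => [/(subsetP sB)|_].
    by rewrite in_setD orbT andbT => /andP[].
  by rewrite orbF andNb.
have leX : (r + hilb X d.+1 <= 'C(m + d, d))%N.
  have := hilb_card_add d sLX; rewrite XDL cB.
  by have := hilb_linsp F d0 km1; lia.
have [g [indg g0]] := ex_vanishing leX; exists g; split=> //.
apply/eqP; rewrite eqn_leq; apply/andP; split.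
  apply: (nzeros_le km1 _ td Er _ indg) => [|j]; first by rewrite d0.
  exact: dhomog_is_dhomog.
have <- : #|X| = (ptsum q k + t)%N.
  by rewrite -(card_linsp F km1) -cB -[LHS](cardsID (linsp F m k)) XDL (setIidPr sLX).
apply/subset_leq_card/subsetP => v Xv; rewrite inE; apply/andP; split; last first.
  by apply/forallP => j; rewrite g0.
move: Xv; rewrite inE => /orP[/(subsetP (linsp_sub F m k)) //|/(subsetP sB)].
by rewrite inE => /andP[].
Qed.

Lemma ev_is_linear : linear (@ev F m).
Proof. by move=> c p p'; apply/rowP => j; rewrite !mxE mevalD mevalZ. Qed.

Definition evS d (p : S d) : 'rV[F]_N := ev p.

Lemma evS_is_linear d : linear (@evS d).
Proof.
by move=> c p p'; rewrite /evS (linearP (@mpoly_of_dhomog m.+1 F d)) ev_is_linear.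
Qed.
HB.instance Definition _ d :=
  GRing.isLinear.Build F (S d) 'rV[F]_N _ (@evS d) (@evS_is_linear d).

(** The rank bound with [k = m.+1] and [s = 0] says that evaluation at all projective points has
    full rank when [d < q]. *)
Lemma evS_inj d : (0 < d < q)%N -> lker (linfun (@evS d)) = 0%VS.
Proof.
move=> dq; have := dim_vanishing (proj_pts F m) d.
have := @hilb_proj_ge F m pts m.+1 0 d (leqnn _) dq (leq0n _) (subxx _).
have cpts : (ptsum q m.+1 + 0 <= #|pts|)%N by rewrite addn0 -Npts_ptsum.
move=> /(_ cpts); rewrite addSn subn1 addn0 succnK.
set K := lker (linfun (@evalX F m pts d)) => le Edim; have /eqP : \dim K = 0%N by lia.
rewrite dimv_eq0 => /eqP K0; apply/eqP; rewrite -subv0 -K0.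
apply/subvP => p; rewrite !memv_ker !lfunE /= => /eqP/rowP p0.
apply/eqP/evalX_eq0 => v pv.
by have := p0 (enum_rank_in pv v); rewrite !mxE enum_rankK_in.
Qed.

(** A position lies outside the support exactly when the corresponding point is a common zero of the
    forms that generate [D]. *)
Lemma card_supp r (f : 'I_r -> {mpoly F[m.+1]}) (D : {vspace 'rV[F]_N}) :
  D = <<[tuple ev (f k) | k < r]>>%VS -> (#|supp D| + nzeros f = N)%N.
Proof.
move=> defD; have -> : nzeros f = #|~: supp D|.
  rewrite /nzeros -(card_imset _ (@enum_val_inj _ (mem pts))).
  apply: eq_card => v; apply/idP/imsetP => [|[j jN ->]].
    rewrite inE => /andP[pv /forallP f0]; exists (enum_rank_in pv v); last by rewrite enum_rankK_in.
    rewrite !inE negb_exists; apply/forallP => c; rewrite negb_and negbK.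
    case: (boolP (c \in D)) => //=; rewrite defD => cD.
    rewrite (coord_span cD) summxE big1 // => k _.
    by rewrite -tnth_nth tnth_mktuple !mxE enum_rankK_in // (eqP (f0 k)) mulr0.
  rewrite inE enum_valP /=; apply/forallP => k; move: jN; rewrite !inE negb_exists.
  move/forallP/(_ (ev (f k))); rewrite mxE negb_and negbK => /orP[|//].
  by rewrite defD memv_span // -(tnth_mktuple (fun k => ev (f k)) k) mem_tnth.
by rewrite cardsC card_ord.
Qed.

End Codes.

(** * Maximal numbers of zeros and generalized Hamming weights *)

Section Main.
Variables (F : finFieldType) (m k d t r : nat).
Hypotheses (m_gt0 : (0 < m)%N) (km : (k <= m)%N) (dq : (0 < d < #|F|)%N) (td : (t < d)%N).
Hypothesis Er : (r + ('C(k + d - 1, d) + t) = 'C(m + d, d))%N.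

Lemma is_e_r_ptsum : @is_e_r F m d r (ptsum #|F| k + t).
Proof.
split=> [|f homf indf]; last exact: nzeros_le (leqW km) dq td Er homf indf.
have [g [indg zg]] := ex_nzeros m_gt0 km dq td Er.
exists (fun j => g j : {mpoly F[m.+1]}); split=> // j; exact: dhomog_is_dhomog.
Qed.

Lemma is_ghw_ptsum :
  is_ghw (@PRM F m d) r (ptsum #|F| m.+1 - ptsum #|F| k - t).
Proof.
split=> [|D dimD D_PRM].
  have [g [indg zg]] := ex_nzeros m_gt0 km dq td Er.
  pose D := <<[tuple ev (g j : {mpoly F[m.+1]}) | j < r]>>%VS; exists D.
  (* As an image under the injective evaluation map, [D] has dimension [r]. *)
  have defD : D = (linfun (@evS F m d) @: <<[tuple g j | j < r]>>)%VS.
    rewrite limg_span /D; congr <<_>>%VS.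
    by rewrite /= -[RHS]map_comp; apply: eq_map => j; rewrite /= lfunE.
  split; [|split] => [|c|].
  - rewrite defD limg_dim_eq; last by rewrite evS_inj // capv0.
    by have /lin_indep_free := indg; rewrite /free size_tuple => /eqP.
  - rewrite defD => /memv_imgP[p _ ->]; rewrite lfunE.
    by exists p; split=> //; apply: dhomog_is_dhomog.
  - have := card_supp (erefl D); have := Npts_ptsum F m; rewrite zg; lia.
(* A basis of [D] is lifted to forms; a relation between them would give one between the basis
   vectors. *)
have /fin_all_exists[f fP] : forall j : 'I_(\dim D), exists p : {mpoly F[m.+1]},
    p \is d.-homog /\ (vbasis D)`_j = ev p.
  by move=> j; apply: D_PRM; apply: vbasis_mem; rewrite mem_nth ?size_tuple.
have defD : D = <<[tuple ev (f j) | j < \dim D]>>%VS.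
  rewrite -{1}(span_basis (vbasisP D)); congr <<_>>%VS.
  apply: (@eq_from_nth _ 0) => [|j]; rewrite !size_tuple // => jD.
  by have [_ ->] := fP (Ordinal jD); rewrite -(tnth_nth _ _ (Ordinal jD)) tnth_mktuple.
have indf : lin_indep f.
  move=> c c0; have /freeP := basis_free (vbasisP D); apply.
  rewrite (eq_bigr (fun j => c j *: ev (f j))) => [|j _]; last by have [_ ->] := fP j.
  have ev_sum : ev (\sum_(j < \dim D) c j *: f j) = \sum_(j < \dim D) c j *: ev (f j).
    apply/rowP => i; rewrite mxE summxE raddf_sum.
    by apply: eq_bigr => j _; rewrite !mxE /= mevalZ.
  by rewrite -ev_sum c0; apply/rowP => i; rewrite !mxE meval0.
have ErD : (\dim D + ('C(k + d - 1, d) + t) = 'C(m + d, d))%N by rewrite dimD.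
have := card_supp defD; have := nzeros_le (leqW km) dq td ErD (fun j => proj1 (fP j)) indf.
by have := Npts_ptsum F m; lia.
Qed.
End Main.

Local Close Scope ring_scope.

Theorem theorem6p4 (F : finFieldType) (m d i t : nat) :
  (1 <= m)%N -> (1 <= d)%N -> (d < #|F|)%N ->
  (1 <= i <= m.+1)%N -> (t < d)%N ->
  let q := #|F| in
  let r := ((\sum_(1 <= a < i.+1) 'C(m + d - a, d - 1)) - t)%N in
  @is_e_r F m d r (pj q (m%:Z - i%:Z) + t)%N /\
  @is_ghw F (Npts F m) (@PRM F m d) r (pj q m%:Z - pj q (m%:Z - i%:Z) - t)%N.
Proof.
move=> m0 d0 dq /andP[i0 im] td q r.
have Er : r + ('C(m.+1 - i + d - 1, d) + t) = 'C(m + d, d).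
  (* The truncated subtraction in [r] is exact: the summand for [a = 1] is at least
     ['C(d, d - 1) = d], because [m] is positive. *)
  rewrite -(sum_bin_hockey d0 im); suff : t <= \sum_(1 <= a < i.+1) 'C(m + d - a, d - 1).
    by rewrite /r; lia.
  rewrite big_ltn // (leq_trans _ (leq_addr _ _)) // ltnW // (leq_trans td) //.
  have /leq_trans-> // : d <= 'C(d, d - 1) by case: (d) d0 => // d' _; rewrite subn1 binSn.
  by rewrite leq_bin2l //; lia.
have km : m.+1 - i <= m by lia.
have dq' : 0 < d < #|F| by rewrite d0.
rewrite pj_ptsum //; split; first exact: is_e_r_ptsum.
exact: is_ghw_ptsum.
Qed.
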